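(* Let $\xi>0$, $\delta>0$, and let $\mathcal{C}:\mathbb{R}^2\times S^1\to[\delta,\infty)$ be a continuously differentiable cost function that is well-defined on $\mathbb{R}^2\times P^1$, i.e. $\mathcal{C}(\mathbf{p})=\mathcal{C}(\overline{\mathbf{p}})$ for all $\mathbf{p}\in\mathbb{R}^2\times S^1$. Then the map $d_{\mathrm{c}}:(\mathbb{R}^2\times P^1)\times(\mathbb{R}^2\times P^1)\to\mathbb{R}_{\ge0}$ defined in the context is symmetric, and for all $[\mathbf{p}_0],[\mathbf{p}_1]\in\mathbb{R}^2\times P^1$ it can be expressed as $$d_{\mathrm{c}}([\mathbf{p}_0],[\mathbf{p}_1])=\inf_{\gamma\in\Gamma^c([\mathbf{p}_0],[\mathbf{p}_1])}L(\gamma),$$ where $\Gamma^c([\mathbf{p}_0],[\mathbf{p}_1])$ is the set of all piecewise $C^1$ curves $\gamma=(\mathbf{x},\mathbf{n}):[0,1]\to\mathbb{R}^2\times S^1$ with $\gamma(0)\in[\mathbf{p}_0]$, $\gamma(1)\in[\mathbf{p}_1]$, $\dot{\mathbf{x}}=u^1\mathbf{n}$, and $u^1$ of constant sign, i.e. $u^1$ is either nonnegative everywhere or nonpositive everywhere.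
   Context: Projective line bundle. $P^1=S^1/\sim$ with $\mathbf{n}_1\sim\mathbf{n}_2\iff\mathbf{n}_1=\pm\mathbf{n}_2$. For $\mathbf{p}=(\mathbf{x},\mathbf{n})\in\mathbb{R}^2\times S^1$ put $\overline{\mathbf{p}}=(\mathbf{x},-\mathbf{n})$; the corresponding point of $\mathbb{R}^2\times P^1$ is the class $[\mathbf{p}]=\{\mathbf{p},\overline{\mathbf{p}}\}$. Curves and controls. For $\mathbf{q}_0,\mathbf{q}_1\in\mathbb{R}^2\times S^1$, $\Gamma_0^+(\mathbf{q}_0,\mathbf{q}_1)$ is the set of piecewise $C^1$ curves $\gamma=(\mathbf{x},\mathbf{n}):[0,1]\to\mathbb{R}^2\times S^1$ with $\gamma(0)=\mathbf{q}_0$, $\gamma(1)=\mathbf{q}_1$, $\dot{\mathbf{x}}\in\mathrm{span}\{\mathbf{n}\}$ a.e. and $\dot{\mathbf{x}}\cdot\mathbf{n}\ge0$ a.e. For a piecewise $C^1$ curve with $\dot{\mathbf{x}}\in\mathrm{span}\{\mathbf{n}\}$ a.e., writing $\mathbf{n}(t)=(\cos\theta(t),\sin\theta(t))$, the controls are $u^1=\dot{\mathbf{x}}\cdot\mathbf{n}$ and $u^3=\dot\theta$ (conditions on velocities and controls are understood almost everywhere). Length and distances. $L(\gamma)=\int_0^1\mathcal{C}(\gamma(t))\sqrt{\xi^2|u^1(t)|^2+|u^3(t)|^2}\,dt$, $d_{\mathcal{F}_0^+}(\mathbf{q}_0,\mathbf{q}_1)=\inf_{\gamma\in\Gamma_0^+(\mathbf{q}_0,\mathbf{q}_1)}L(\gamma)$,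 and $$d_{\mathrm{c}}([\mathbf{p}_0],[\mathbf{p}_1])=\min_{\mathbf{q}_0\in[\mathbf{p}_0],\,\mathbf{q}_1\in[\mathbf{p}_1]}d_{\mathcal{F}_0^+}(\mathbf{q}_0,\mathbf{q}_1).$$ *)

(* Defs.v *)
From HB Require Import structures.
From mathcomp Require Import all_boot all_order all_algebra.
From mathcomp Require Import all_classical all_reals all_analysis.

Set Implicit Arguments.
Unset Strict Implicit.
Unset Printing Implicit Defensive.

Import Order.TTheory GRing.Theory Num.Theory.
Import numFieldNormedType.Exports.

Local Open Scope classical_set_scope.
Local Open Scope ring_scope.
Local Open Scope quotient_scope.

Definition dot (R : realType) (u v : 'rV[R]_2) : R := \sum_(i < 2) u 0 i * v 0 i.

Definition S1 (R : realType) : Type := {n : 'rV[R]_2 | dot n n == 1}.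

Lemma dotNN (R : realType) (u v : 'rV[R]_2) : dot (- u) (- v) = dot u v.
Proof. by apply: eq_bigr => i _; rewrite !mxE mulrNN. Qed.

Lemma S1_opp_subproof (R : realType) (n : S1 R) : dot (- val n) (- val n) == 1.
Proof. by rewrite dotNN (valP n). Qed.

Definition S1_opp (R : realType) (n : S1 R) : S1 R :=
  exist _ (- val n) (S1_opp_subproof n).

Lemma S1_oppK (R : realType) : involutive (@S1_opp R).
Proof. by move=> n; apply: val_inj => /=; rewrite opprK. Qed.

Definition cossin (R : realType) (a : R) : 'rV[R]_2 :=
  \row_(j < 2) (if j == 0 then cos a else sin a).

Lemma cossin_subproof (R : realType) (a : R) : dot (cossin a) (cossin a) == 1.
Proof. by rewrite /dot !big_ord_recl big_ord0 !mxE /= addr0 -!expr2 cos2Dsin2. Qed.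

Definition angle (R : realType) (a : R) : S1 R := exist _ (cossin a) (cossin_subproof a).

Definition antipodal (R : realType) : rel (S1 R) :=
  [rel n1 n2 | (n1 == n2) || (n1 == S1_opp n2)].

Lemma antipodal_is_equiv (R : realType) : equiv_class_of (@antipodal R).
Proof.
split=> [n|n m|n m p]; rewrite /antipodal /=; first by rewrite eqxx.
- by rewrite eq_sym -(inv_eq (@S1_oppK R)) [S1_opp n == m]eq_sym.
- by move=> /orP[]/eqP-> /orP[]/eqP->; rewrite ?S1_oppK eqxx ?orbT.
Qed.

Canonical antipodal_equiv (R : realType) := EquivRelPack (@antipodal_is_equiv R).

Definition P1 (R : realType) := {eq_quot (antipodal_equiv R)}.

Definition R2S1 (R : realType) : Type := ('rV[R]_2 * S1 R)%type.

Definition R2P1 (R : realType) : Type := ('rV[R]_2 * P1 R)%type.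

Definition bar (R : realType) (p : R2S1 R) : R2S1 R := (p.1, S1_opp p.2).

(* The elements of R2P1 R are the classes [p]; [members P] is the class P seen
   as a subset {p, bar p} of R2S1 R. *)
Definition cls (R : realType) (p : R2S1 R) : R2P1 R := (p.1, \pi_(P1 R) p.2).

Definition members (R : realType) (P : R2P1 R) : set (R2S1 R) :=
  [set p | cls p = P].

Lemma cls_surj (R : realType) (P : R2P1 R) : exists p, P = cls p.
Proof. by case: P => x n; exists (x, repr n); rewrite /cls /= reprK. Qed.

Lemma members_cls (R : realType) (p : R2S1 R) : members (cls p) = [set p; bar p].
Proof.
case: p => x n; apply/seteqP; split=> -[y m]; rewrite /members /cls /bar /=.
- by case=> -> /eqmodP /= /orP[]/eqP->; [left|right].
- by case=> -[-> ->]; congr (_, _); apply/eqmodP; rewrite /= /antipodal /= eqxx ?orbT.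
Qed.

(* Continuous differentiability on R^2 x S^1, read in the charts given by the
   angle (local inverses of the covering R^2 x R -> R^2 x S^1). *)
Definition C1_cost (R : realType) (C : R2S1 R -> R) : Prop :=
  let f := fun p : 'rV[R]_2 * R => C (p.1, angle p.2) in
  (forall p, differentiable f p) /\
  (forall v, continuous (fun p => 'd f p v)).

(* C^1 on the closed interval [a, b], i.e. up to the end points. *)
Definition C1_on (R : realType) (V : normedModType R) (a b : R) (f : R -> V) : Prop :=
  exists g : R -> V,
    [/\ forall t, derivable g t 1, continuous (derive1 g) &
        forall t, t \in `[a, b] -> f t = g t].

(* The pieces are closed intervals sharing their end points, so that a
   piecewise C^1 map is in particular continuous on [0, 1]. *)
Definition piecewise_C1 (R : realType) (V : normedModType R) (f : R -> V) : Prop :=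
  exists s : seq R,
    [/\ path <%R 0 s, last 0 s = 1 &
        forall i, (i < size s)%N -> C1_on (nth 0 (0 :: s) i) (nth 0 s i) f].

(* Curves [0, 1] -> R^2 x S^1 are represented by functions on the whole line,
   whose values outside [0, 1] are irrelevant. *)
Definition xpart (R : realType) (g : R -> R2S1 R) (t : R) : 'rV[R]_2 := (g t).1.

Definition npart (R : realType) (g : R -> R2S1 R) (t : R) : 'rV[R]_2 := val (g t).2.

Definition pwC1_curve (R : realType) (g : R -> R2S1 R) : Prop :=
  piecewise_C1 (xpart g) /\ piecewise_C1 (npart g).

Definition ae01 (R : realType) (P : R -> Prop) : Prop :=
  {ae @lebesgue_measure R, forall t, t \in `[0, 1] -> P t}.

Definition u1 (R : realType) (g : R -> R2S1 R) (t : R) : R :=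
  dot (derive1 (xpart g) t) (npart g t).

Definition is_angle_lift (R : realType) (g : R -> R2S1 R) (theta : R -> R) : Prop :=
  {within `[0, 1], continuous theta} /\
  forall t, t \in `[0, 1] -> (g t).2 = angle (theta t).

(* A continuous angle exists along every continuous curve and is unique on
   [0, 1] up to an additive constant in 2 pi Z, which [u3] does not see. *)
Definition angle_lift (R : realType) (g : R -> R2S1 R) : R -> R :=
  xget (fun=> 0) [set theta | is_angle_lift g theta].

Definition u3 (R : realType) (g : R -> R2S1 R) (t : R) : R := derive1 (angle_lift g) t.

Definition curve_length (R : realType) (xi : R) (C : R2S1 R -> R)
    (g : R -> R2S1 R) : \bar R :=
  (\int[@lebesgue_measure R]_(t in `[0%R, 1%R])
     (C (g t) * Num.sqrt (xi ^+ 2 * `|u1 g t| ^+ 2 + `|u3 g t| ^+ 2))%:E)%E.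

Definition Gamma0p (R : realType) (q0 q1 : R2S1 R) : set (R -> R2S1 R) :=
  [set g | [/\ pwC1_curve g, g 0 = q0, g 1 = q1,
               ae01 (fun t => exists c : R, derive1 (xpart g) t = c *: npart g t) &
               ae01 (fun t => 0 <= u1 g t)]].

Definition d_F0p (R : realType) (xi : R) (C : R2S1 R -> R) (q0 q1 : R2S1 R) : \bar R :=
  ereal_inf [set curve_length xi C g | g in Gamma0p q0 q1].

(* The infimum ranges over at most four values, so it is a minimum (d_c_min). *)
Definition d_c (R : realType) (xi : R) (C : R2S1 R -> R) (P0 P1 : R2P1 R) : \bar R :=
  ereal_inf [set d_F0p xi C q0 q1 | q0 in members P0 & q1 in members P1].

Lemma d_c_min (R : realType) (xi : R) (C : R2S1 R -> R) (P0 P1 : R2P1 R) :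
  (exists q0 q1, [/\ members P0 q0, members P1 q1 & d_c xi C P0 P1 = d_F0p xi C q0 q1]) /\
  (forall q0 q1, members P0 q0 -> members P1 q1 -> (d_c xi C P0 P1 <= d_F0p xi C q0 q1)%E).
Proof.
split; last first.
  by move=> q0 q1 h0 h1; apply: ereal_inf_lbound; exists q0 => //; exists q1.
have [p0 ->] := cls_surj P0; have [p1 ->] := cls_surj P1.
pose q (i : bool * bool) := (if i.1 then p0 else bar p0, if i.2 then p1 else bar p1).
pose F i := d_F0p xi C (q i).1 (q i).2.
have [i _ Fi] := @arg_minP _ _ _ (true, true) predT F isT.
have mq j : members (cls p0) (q j).1 /\ members (cls p1) (q j).2.
  by rewrite !members_cls; case: j => -[] [] /=; split; by [left|right].
exists (q i).1, (q i).2; have [m0 m1] := mq i; split=> //.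
apply/eqP; rewrite eq_le; apply/andP; split.
  by apply: ereal_inf_lbound; exists (q i).1 => //; exists (q i).2.
apply: le_ereal_inf_tmp => _ [q0 + [q1 + <-]]; rewrite !members_cls.
case=> -> [] ->; [exact: (Fi (true, true))|exact: (Fi (true, false))
  |exact: (Fi (false, true))|exact: (Fi (false, false))].
Qed.

Definition Gammac (R : realType) (P0 P1 : R2P1 R) : set (R -> R2S1 R) :=
  [set g | [/\ pwC1_curve g, members P0 (g 0), members P1 (g 1),
               ae01 (fun t => derive1 (xpart g) t = u1 g t *: npart g t) &
               ae01 (fun t => 0 <= u1 g t) \/ ae01 (fun t => u1 g t <= 0)]].

(* Main.v *)
Require Import Defs.
From mathcomp Require Import all_boot all_order all_algebra.
From mathcomp Require Import all_classical all_reals all_analysis measurable_realfun.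
From mathcomp Require Import ring lra.

Import Order.TTheory GRing.Theory Num.Theory.
Import numFieldNormedType.Exports.

Local Open Scope classical_set_scope.
Local Open Scope ring_scope.

(** Reversing a curve in time, and replacing [n] by [-n] along it, each change the
sign of [u1] and preserve [|u3|], hence the length. The first operation exchanges
the two end points of a curve in [Gammac] and gives the symmetry; the second turns
a curve with [u1 <= 0] into one with [u1 >= 0] without changing the classes of its
end points, and gives the formula for [d_c]. Finiteness follows by turning,
driving straight ahead, and turning again. *)

(** * Derivatives and piecewise $C^1$ maps under time reversal and negation *)

(* The limit defining [derive1] takes the default value [point], here [0], when it
   does not exist; so [derive1_reverse] below needs no differentiability. *)
Lemma derive1_nderivable (R : realType) (f : R -> R) (t : R) :
  ~ derivable f t 1 -> derive1 f t = 0.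
Proof.
rewrite derive1E => nd; rewrite /derive /lim /lim_in /= /get /xget.
case: pselect => //= -[l fl].
by exfalso; apply: nd; apply/cvg_ex; exists l; exact: asboolW fl.
Qed.

Lemma derive1_rV_nderivable (R : realType) (n : nat) (f : R -> 'rV[R]_n) (t : R) :
  ~ derivable f t 1 -> derive1 f t = 0.
Proof.
rewrite derive1E => nd; rewrite /derive /lim /lim_in /= /get /xget.
case: pselect => //= [[l fl]|_]; last by apply/matrixP => i j; rewrite !mxE.
by exfalso; apply: nd; apply/cvg_ex; exists l; exact: asboolW fl.
Qed.

Lemma is_derive_reverse (R : realType) (V : normedModType R) (f : R -> V) (t : R) :
  derivable f (1 - t) 1 ->
  is_derive t (1 : R) (fun s : R => f (1 - s)) (- derive1 f (1 - t)).
Proof.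
move=> df.
have dr : derivable (fun s : R => 1 - s : R^o) t 1.
  by apply: derivableB.
have /derivable1_diffP dr' := dr; have /derivable1_diffP df' := df.
have dfr : differentiable (f \o (fun s : R => 1 - s)) t by exact: differentiable_comp.
apply: DeriveDef; first exact/derivable1_diffP.
rewrite deriveE// diff_comp//= -derive1E'//.
have /(congr1 (@^~ t)) -> := @derive1_onem R.
by rewrite linearN -derive1E'.
Qed.

Lemma derivable_reverse (R : realType) (V : normedModType R) (f : R -> V) (t : R) :
  derivable (fun s : R => f (1 - s)) t 1 -> derivable f (1 - t) 1.
Proof.
move=> df; have -> : f = (fun s : R => f (1 - (1 - s))).
  by apply/funext => s; rewrite subKr.
apply: ex_derive; apply: (@is_derive_reverse _ _ (fun s : R => f (1 - s))).
by rewrite subKr.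
Qed.

Lemma derive1_reverse (R : realType) (f : R -> R) (t : R) :
  derive1 (fun s : R => f (1 - s)) t = - derive1 f (1 - t).
Proof.
have [df|ndf] := pselect (derivable f (1 - t) 1).
  by rewrite derive1E; apply: derive_val; exact: is_derive_reverse.
rewrite derive1_nderivable; first by rewrite (derive1_nderivable _ _ _ ndf) oppr0.
by move=> /derivable_reverse.
Qed.

Lemma derive1_rV_reverse (R : realType) (n : nat) (f : R -> 'rV[R]_n) (t : R) :
  derive1 (fun s : R => f (1 - s)) t = - derive1 f (1 - t).
Proof.
have [df|ndf] := pselect (derivable f (1 - t) 1).
  by rewrite derive1E; apply: derive_val; exact: is_derive_reverse.
rewrite derive1_rV_nderivable; first by rewrite (derive1_rV_nderivable _ _ _ _ ndf) oppr0.
by move=> /derivable_reverse.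
Qed.

Lemma continuous_onem (R : realType) : continuous (fun s : R => 1 - s).
Proof. by move=> s; apply: continuousB; [exact: cvg_cst|exact: cvg_id]. Qed.

Lemma C1_on_reverse (R : realType) (V : normedModType R) (a b : R) (f : R -> V) :
  C1_on a b f -> C1_on (1 - b) (1 - a) (fun s : R => f (1 - s)).
Proof.
case=> g [dg cg fg]; exists (fun s : R => g (1 - s)); split.
- by move=> t; exact: (@ex_derive _ _ _ _ _ _ _ (is_derive_reverse _ _ _ _ (dg _))).
- have -> : derive1 (fun s : R => g (1 - s)) = fun t => - derive1 g (1 - t).
    by apply/funext => t; rewrite derive1E; apply: derive_val; exact: is_derive_reverse.
  move=> t; apply: cvgN; apply: (@continuous_comp _ _ _ (fun s : R => 1 - s)).
    exact: continuous_onem.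
  exact: cg.
- by move=> t; rewrite in_itv /= => /andP[bt ta]; apply: fg; rewrite in_itv /=; lra.
Qed.

Lemma C1_on_opp (R : realType) (V : normedModType R) (a b : R) (f : R -> V) :
  C1_on a b f -> C1_on a b (fun s : R => - f s).
Proof.
case=> g [dg cg fg]; exists (fun s : R => - g s); split.
- by move=> t; apply: derivableN.
- have -> : derive1 (fun s : R => - g s) = fun t => - derive1 g t.
    by apply/funext => t; rewrite !derive1E deriveN.
  by move=> t; apply: cvgN; exact: cg.
- by move=> t /fg ->.
Qed.

Lemma piecewise_C1_opp (R : realType) (V : normedModType R) (f : R -> V) :
  piecewise_C1 f -> piecewise_C1 (fun s : R => - f s).
Proof. by case=> s [ps ls fs]; exists s; split=> // i /fs; exact: C1_on_opp. Qed.

Lemma piecewise_C1_reverse (R : realType) (V : normedModType R) (f : R -> V) :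
  piecewise_C1 f -> piecewise_C1 (fun s : R => f (1 - s)).
Proof.
(* The full list of break points is [0 :: s]. Its mirror image starts with [1 - last 0 s = 0], which
   [piecewise_C1] leaves implicit; [belast] removes it. *)
case=> s [ps ls fs]; exists (map (fun t => 1 - t) (rev (belast 0 s))).
have E : 0 :: map (fun t => 1 - t) (rev (belast 0 s)) = map (fun t => 1 - t) (rev (0 :: s)).
  by rewrite (lastI 0 s) rev_rcons /= ls subrr.
have hs : (0 < size s)%N.
  by case: {+}s ls => //= /eqP; rewrite eq_sym oner_eq0.
split.
- move: ps; rewrite -rev_path ls => ps.
  have : path <%R (1 - 1) [seq 1 - t | t <- rev (belast 0 s)].
    apply: (homo_path (f := fun t : R => 1 - t) _ ps) => x y /=.
    by rewrite ltrD2l ltrN2.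
  by rewrite subrr.
- rewrite -(last_cons 0) E.
  by rewrite rev_cons map_rcons last_rcons subr0.
(* Piece [i] of the mirrored subdivision is the mirror image of piece [size s - i.+1] of the
   original one. *)
- rewrite size_map size_rev size_belast => i ilt.
  rewrite E (nth_map 0) ?size_rev /= ?ltnS 1?ltnW// (nth_map 0) ?size_rev ?size_belast//.
  rewrite (nth_rev (s := 0 :: s) _ (leqW ilt)) nth_rev ?size_belast// subSS.
  have -> : (size s - i = (size s - i.+1).+1)%N by rewrite subnSK.
  rewrite /= -/(belast 0 s).
  have -> : nth 0 (belast 0 s) (size s - i.+1) = nth 0 (0 :: s) (size s - i.+1).
    by rewrite [in RHS]lastI nth_rcons size_belast; case: ifP => //; rewrite ltn_subrL hs.
  by apply: C1_on_reverse; apply: fs; rewrite ltn_subrL hs.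
Qed.

(** * Integrals of nonnegative functions and the substitution [t -> 1 - t] *)

(* The integral of a nonnegative function is a supremum over the simple functions
   below it, so that the length of a curve can be handled without proving its
   integrand measurable. *)
Lemma ge0_le_integral_nomeas (d : measure_display) (T : measurableType d) (R : realType)
    (mu : {measure set T -> \bar R}) (D : set T) (f g : T -> \bar R) :
  (forall t, D t -> (0 <= f t)%E) -> (forall t, D t -> (f t <= g t)%E) ->
  (\int[mu]_(t in D) f t <= \int[mu]_(t in D) g t)%E.
Proof.
move=> f0 fg; have g0 t : D t -> (0 <= g t)%E by move=> Dt; exact: le_trans (f0 _ Dt) (fg _ Dt).
rewrite !ge0_integralE//; apply: ereal_sup_le => _ [h hf <-].
exists h => // t; apply: le_trans (hf t) _.
by apply: lee_restrict => s Ds; exact: fg.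
Qed.

Import HBNNSimple.

(** Upper bounds on an integral are reduced to simple functions [h]. These are measurable, so the
    change-of-variables results apply to them even when they do not apply to [f]. *)
Lemma ge0_integral_le_nnsfun (d : measure_display) (T : measurableType d) (R : realType)
    (mu : {measure set T -> \bar R}) (D : set T) (f : T -> \bar R) (M : \bar R) :
  measurable D -> (forall t, D t -> (0 <= f t)%E) ->
  (forall h : {nnsfun T >-> R}, (forall t, D t -> ((h t : R)%:E <= f t)%E) ->
     (\int[mu]_(t in D) (h t : R)%:E <= M)%E) ->
  (\int[mu]_(t in D) f t <= M)%E.
Proof.
move=> mD f0 hM; rewrite ge0_integralE//; apply: ge_ereal_sup => _ [h hf <-].
(* The integral over [D] is that of [f] extended by zero, so a simple function below this extension
   vanishes off [D]. *)
have hD t : ~ D t -> h t = 0.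
  move=> nDt; apply/eqP; rewrite eq_le fun_ge0 andbT -lee_fin.
  by apply: le_trans (hf t) _; rewrite patchN// notin_setE.
have -> : sintegral mu h = (\int[mu]_(t in D) (h t : R)%:E)%E.
  rewrite integral_nnsfun//; apply: eq_sintegral => t.
  by rewrite /patch; case: ifPn => //; rewrite notin_setE => /hD.
apply: hM => t Dt; apply: le_trans (hf t) _.
by rewrite patchE mem_set.
Qed.

(** The end points have to be discarded because [u3] there depends on values of the lift outside
    [[0, 1]], which are arbitrary. *)
Lemma ge0_integral_cc_oo (R : realType) (a b : R) (f : R -> \bar R) :
  (forall t, (0 <= f t)%E) ->
  (\int[lebesgue_measure]_(t in `[a, b]) f t = \int[lebesgue_measure]_(t in `]a, b[) f t)%E.
Proof.
move=> f0; apply/eqP; rewrite eq_le; apply/andP; split.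
  apply: ge0_integral_le_nnsfun => // h hf.
  rewrite integral_itv_bndoo; last first.
    apply/measurable_EFinP; apply: measurable_funTS.
    exact: (@measurable_funP _ _ _ _ setT h).
  apply: ge0_le_integral_nomeas => [t _|t abt]; first by rewrite lee_fin.
  by apply: hf; exact: subset_itv_oo_cc.
rewrite integral_mkcond [leRHS]integral_mkcond.
apply: ge0_le_integral_nomeas => t _; first exact: erestrict_ge0.
apply: restrict_lee => // s; exact: subset_itv_oo_cc.
Qed.

Lemma measurable_reverse (R : realType) :
  measurable_fun [set: measurableTypeR R]
    ((fun t : R => 1 - t) : measurableTypeR R -> measurableTypeR R).
Proof. exact: (continuous_measurable_fun (@continuous_onem R)). Qed.

(** Lebesgue measure is determined by its values on the intervals []a, b]], and the preimage [[1 -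
    b, 1 - a[] has the same length. *)
Lemma pushforward_lebesgue_reverse (R : realType) (A : set R) : measurable A ->
  pushforward lebesgue_measure ((fun t : R => 1 - t) : _ -> measurableTypeR R) A =
  lebesgue_measure A.
Proof.
move=> mA; apply/esym/lebesgue_measure_unique => //=; first exact: measurable_reverse.
move=> _ _ [[a b]] _ <-.
rewrite /pushforward (_ : _ @^-1` _ = `[1 - b, 1 - a[%classic); last first.
  by apply/seteqP; split => t /=; rewrite !in_itv /=; lra.
rewrite !lebesgue_measure_itv/= !lte_fin ltrD2l ltrN2.
by case: ifP => // _; rewrite -!EFinB; congr (_%:E); lra.
Qed.

Lemma reverse_preimage_itv (R : realType) :
  (fun t : R => 1 - t) @^-1` `]0, 1[ = `]0, 1[%classic.
Proof. by apply/seteqP; split => t /=; rewrite !in_itv /=; lra. Qed.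

Lemma ge0_integral_reverse (R : realType) (f : R -> \bar R) :
  (forall t, (0 <= f t)%E) ->
  (\int[lebesgue_measure]_(t in `]0%R, 1%R[) f (1 - t)%R =
   \int[lebesgue_measure]_(t in `]0%R, 1%R[) f t)%E.
Proof.
(* Reversal is an involution, so one inequality, applied to [f] and to its reversal, gives both. *)
suff le (g : R -> \bar R) : (forall t, (0 <= g t)%E) ->
  (\int[lebesgue_measure]_(t in `]0%R, 1%R[) g t <=
   \int[lebesgue_measure]_(t in `]0%R, 1%R[) g (1 - t)%R)%E.
  move=> f0; apply/eqP; rewrite eq_le le// andbT.
  have := le (fun t => f (1 - t)) (fun t => f0 _).
  by under [leRHS]eq_integral do rewrite subKr.
move=> g0; apply: ge0_integral_le_nnsfun => // h hg.
have mh : measurable_fun (`]0, 1[%classic : set (measurableTypeR R))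
    (fun t : measurableTypeR R => (h t : R)%:E).
  apply/measurable_EFinP; apply: measurable_funTS.
  exact: (@measurable_funP _ _ _ _ setT h).
(* For the measurable [h] this is the invariance of Lebesgue measure; the reversal of [h] then lies
   below that of [g]. *)
have -> : (\int[lebesgue_measure]_(t in `]0%R, 1%R[) (h t : R)%:E =
           \int[lebesgue_measure]_(t in `]0%R, 1%R[) (h (1 - t)%R : R)%:E)%E.
  rewrite -[in RHS]reverse_preimage_itv.
  rewrite -(@ge0_integral_pushforward _ _ _ _ _ _ (measurable_reverse R) _ _
    (fun t : measurableTypeR R => (h t : R)%:E))//; last first.
    by move=> t _; rewrite /= lee_fin.
  apply: eq_measure_integral; first exact: measurable_reverse.
  by move=> mr A mA _; exact/esym/pushforward_lebesgue_reverse.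
apply: ge0_le_integral_nomeas => t; rewrite /= in_itv /= => t01; first by rewrite lee_fin.
by apply: hg; rewrite /= in_itv /=; lra.
Qed.

(** * Almost everywhere statements on [[0, 1]] *)

Lemma ae01S (R : realType) (P Q : R -> Prop) :
  (forall t, t \in `[0, 1] -> P t -> Q t) -> ae01 P -> ae01 Q.
Proof.
move=> PQ [A [mA A0 PA]]; exists A; split=> // t /= nQ; apply: PA => /= Pt.
by apply: nQ => t01; exact/PQ/Pt.
Qed.

Lemma ae01_reverse (R : realType) (P : R -> Prop) :
  ae01 P -> ae01 (fun t => P (1 - t)).
Proof.
case=> A [mA A0 PA]; exists ((fun t : R => 1 - t) @^-1` A); split.
- by rewrite -[X in measurable X]setTI; exact: measurable_reverse.
- by rewrite -A0; exact: pushforward_lebesgue_reverse.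
- move=> t /= nP; apply: PA => /= Pt; apply: nP.
  by rewrite in_itv /= => t01; apply: Pt; rewrite in_itv /=; lra.
Qed.

Lemma ae01_finite (R : realType) (s : seq R) (P : R -> Prop) :
  (forall t, t \in `[0, 1] -> t \notin s -> P t) -> ae01 P.
Proof.
move=> sP; have fs : finite_set [set` s] by exact: finite_seq.
exists [set` s]; split.
- apply: countable_measurable; [exact: measurable_set1|exact: finite_set_countable].
- by apply: countable_lebesgue_measure0; exact: finite_set_countable.
- move=> t /=; apply: contra_notP => /negP ts t01; exact: sP.
Qed.

(** * The two operations on curves and their effect on [u1] *)

Definition reverse {R : realType} (g : R -> R2S1 R) (t : R) : R2S1 R := g (1 - t).

Definition flip {R : realType} (g : R -> R2S1 R) (t : R) : R2S1 R := bar (g t).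

Lemma flipK (R : realType) : involutive (@flip R).
Proof.
by move=> g; apply/funext => t; rewrite /flip /bar /= S1_oppK; case: (g t).
Qed.

Lemma reverseK (R : realType) : involutive (@reverse R).
Proof. by move=> g; apply/funext => t; rewrite /reverse subKr. Qed.

Lemma pwC1_curve_reverse (R : realType) (g : R -> R2S1 R) :
  pwC1_curve g -> pwC1_curve (reverse g).
Proof. by case=> cx cn; split; [exact: piecewise_C1_reverse cx|exact: piecewise_C1_reverse cn]. Qed.

Lemma pwC1_curve_flip (R : realType) (g : R -> R2S1 R) :
  pwC1_curve g -> pwC1_curve (flip g).
Proof. by case=> cx cn; split=> //; exact: piecewise_C1_opp cn. Qed.

Lemma dotZl (R : realType) (c : R) (u v : 'rV[R]_2) : dot (c *: u) v = c * dot u v.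
Proof. by rewrite /dot mulr_sumr; apply: eq_bigr => i _; rewrite mxE mulrA. Qed.

Lemma dotNl (R : realType) (u v : 'rV[R]_2) : dot (- u) v = - dot u v.
Proof. by rewrite -scaleN1r dotZl mulN1r. Qed.

Lemma dotNr (R : realType) (u v : 'rV[R]_2) : dot u (- v) = - dot u v.
Proof. by rewrite -[u in LHS]opprK dotNN dotNl. Qed.

Lemma dot_npart (R : realType) (g : R -> R2S1 R) (t : R) : dot (npart g t) (npart g t) = 1.
Proof. exact/eqP/(valP (g t).2). Qed.

Lemma derive1_xpart_reverse (R : realType) (g : R -> R2S1 R) (t : R) :
  derive1 (xpart (reverse g)) t = - derive1 (xpart g) (1 - t).
Proof. exact: (@derive1_rV_reverse _ _ (xpart g)). Qed.

Lemma u1_reverse (R : realType) (g : R -> R2S1 R) (t : R) :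
  u1 (reverse g) t = - u1 g (1 - t).
Proof. by rewrite /u1 derive1_xpart_reverse dotNl. Qed.

Lemma u1_flip (R : realType) (g : R -> R2S1 R) (t : R) : u1 (flip g) t = - u1 g t.
Proof. by rewrite /u1 dotNr. Qed.

(** * Angle lifts and the effect of the two operations on [u3] *)

Lemma angleDpi (R : realType) (a : R) : angle (a + pi) = S1_opp (angle a).
Proof.
apply: val_inj; apply/rowP => j; rewrite !mxE cosDpi sinDpi.
by case: ifP.
Qed.

Lemma is_angle_lift_flip (R : realType) (g : R -> R2S1 R) (theta : R -> R) :
  is_angle_lift g theta -> is_angle_lift (flip g) (fun t => theta t + pi).
Proof.
case=> ct gt; split; first by move=> t; apply: cvgD; [exact: ct|exact: cvg_cst].
by move=> t /gt gtE; rewrite /flip /= gtE angleDpi.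
Qed.

Lemma is_angle_lift_reverse (R : realType) (g : R -> R2S1 R) (theta : R -> R) :
  is_angle_lift g theta -> is_angle_lift (reverse g) (fun t => theta (1 - t)).
Proof.
case=> ct gt; split; last first.
  by move=> t; rewrite in_itv /= => t01; apply: gt; rewrite in_itv /=; lra.
move/subspace_continuousP : ct => ct; apply/subspace_continuousP => t.
rewrite /= in_itv /= => t01.
apply: (@cvg_comp _ _ _ (fun s : R => 1 - s) theta); last first.
  by apply: ct; rewrite /= in_itv /=; lra.
move=> A; rewrite /= !nbhs_simpl /= => /continuous_onem.
apply: (@filterS _ (nbhs t)) => s + s01; apply; move: s01; rewrite /= !in_itv /=; lra.
Qed.

(* The difference of two lifts takes values in the discrete set [2 pi Z], hence is
   constant by the intermediate value theorem. *)
Lemma is_angle_lift_unique (R : realType) (g : R -> R2S1 R) (th1 th2 : R -> R) :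
  is_angle_lift g th1 -> is_angle_lift g th2 ->
  exists k, forall t, t \in `[0, 1] -> th1 t = th2 t + k.
Proof.
case=> c1 g1 [c2 g2]; pose D t := th1 t - th2 t.
have cD : {within `[0, 1], continuous D} by move=> t; apply: cvgB; [exact: c1|exact: c2].
have cosD1 t : t \in `[0, 1] -> cos (D t) = 1.
  move=> t01; have := g1 t t01; rewrite (g2 t t01) => /(congr1 (fun n => val n)) /rowP E.
  have := E 0; have := E 1; rewrite !mxE /= => s2 c2'.
  by rewrite /D cosB -s2 -c2' -!expr2 cos2Dsin2.
have sinD0 t : t \in `[0, 1] -> sin (D t) = 0.
  move=> /cosD1 cD1; have /eqP := cos2Dsin2 (D t).
  by rewrite cD1 expr1n -subr_eq0 addrAC subrr add0r sqrf_eq0 => /eqP.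
(* Two distinct values of [D] cannot be less than [pi] apart: the sine of their difference would be
   positive, while the subtraction formula gives 0. *)
have noval x y : x \in `[0, 1] -> y \in `[0, 1] -> D x < D y < D x + pi -> False.
  move=> x01 y01 xy; have := sin_gt0_pi (x := D y - D x).
  rewrite sinB (sinD0 y)// (sinD0 x)// mul0r mulr0 subrr ltxx.
  by move=> h; suff : false by []; apply: h; lra.
have pi0 := pi_gt0 R.
have ivt x y v : x \in `[0, 1] -> y \in `[0, 1] -> D x < v < D y ->
    exists2 c, c \in `[0, 1] & D c = v.
  rewrite !in_itv /= => /andP[x0 x1] /andP[y0 y1] /andP[xv vy].
  have [xy|yx] := leP x y.
    have sub : `[x, y]%classic `<=` `[0, 1]%classic by move=> s; rewrite /= !in_itv /=; lra.
    have [|c /sub c01 cv] := @IVT _ D x y v xy (continuous_subspaceW sub cD).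
      by rewrite ge_min le_max (ltW xv) (ltW vy) orbT.
    by exists c.
  have sub : `[y, x]%classic `<=` `[0, 1]%classic by move=> s; rewrite /= !in_itv /=; lra.
  have [|c /sub c01 cv] := @IVT _ D y x v (ltW yx) (continuous_subspaceW sub cD).
    by rewrite ge_min le_max (ltW xv) (ltW vy) orbT.
  by exists c.
have nlt x y : x \in `[0, 1] -> y \in `[0, 1] -> D x < D y -> False.
  (* If [D y] is at least [pi] above [D x], the intermediate value theorem yields the value
     [D x + pi / 2], which is also excluded. *)
  move=> x01 y01 xy; have [near|far] := ltP (D y) (D x + pi).
    by apply: (noval x y) => //; rewrite xy.
  have [|c c01 Dc] := ivt x y (D x + pi / 2) x01 y01; first lra.
  by apply: (noval x c) => //; rewrite Dc; lra.
have zero01 : (0 : R) \in `[0, 1] by rewrite in_itv /= lexx ler01.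
exists (D 0) => t t01; have : D t = D 0 by case: (ltgtP (D t) (D 0)) => // /nlt; case.
by rewrite {1}/D => <-; rewrite addrC subrK.
Qed.

Lemma derive1_addr (R : realType) (f : R -> R) (k t : R) :
  derive1 (fun s => f s + k) t = derive1 f t.
Proof.
rewrite /derive1; set F := (fun h => _); set G := (fun h => _).
suff -> : F = G by [].
by apply/funext => h; rewrite /F /G opprD addrACA subrr addr0.
Qed.

(** [angle_lift] is an arbitrary choice, but any other lift differs from it by a constant on
    [[0, 1]]. At an interior point this covers a whole neighbourhood, so the derivatives agree. *)
Lemma u3E (R : realType) (g : R -> R2S1 R) (theta : R -> R) (t : R) :
  is_angle_lift g theta -> t \in `]0, 1[ -> u3 g t = derive1 theta t.
Proof.
move=> lift t01.
have lift' : is_angle_lift g (angle_lift g) by exact: (xgetPex (fun=> 0) (ex_intro _ _ lift)).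
have [k kE] := is_angle_lift_unique _ _ _ _ lift' lift.
rewrite /u3; transitivity (derive1 (fun s => theta s + k) t).
  rewrite !derive1E; apply: near_eq_derive; have := near_in_itvoo t01.
  apply: (@filterS _ (nbhs t)) => s s01.
  by apply: kE; move: s01; rewrite !in_itv /=; lra.
exact: derive1_addr.
Qed.

(** Here [xget] falls back on the zero function. Treating this case makes the next two lemmas valid
    for arbitrary [g], with no appeal to the existence of lifts. *)
Lemma u3_nolift (R : realType) (g : R -> R2S1 R) (t : R) :
  ~ (exists theta, is_angle_lift g theta) -> u3 g t = 0.
Proof.
move=> nl; rewrite /u3 /angle_lift xgetPN; first by rewrite derive1_cst.
by move=> th lth; apply: nl; exists th.
Qed.

Lemma u3_flip (R : realType) (g : R -> R2S1 R) (t : R) :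
  t \in `]0, 1[ -> u3 (flip g) t = u3 g t.
Proof.
move=> t01; have [[th lth]|nl] := pselect (exists theta, is_angle_lift g theta).
  rewrite (u3E _ _ _ _ lth)// (u3E _ _ _ _ (is_angle_lift_flip _ _ _ lth))//.
  exact: derive1_addr.
rewrite !u3_nolift// => -[th] /is_angle_lift_flip; rewrite flipK => lth.
by apply: nl; eexists; exact: lth.
Qed.

Lemma u3_reverse (R : realType) (g : R -> R2S1 R) (t : R) :
  t \in `]0, 1[ -> u3 (reverse g) t = - u3 g (1 - t).
Proof.
move=> t01; have [[th lth]|nl] := pselect (exists theta, is_angle_lift g theta).
  rewrite (u3E _ _ _ _ lth); last by move: t01; rewrite !in_itv /=; lra.
  by rewrite (u3E _ _ _ _ (is_angle_lift_reverse _ _ _ lth))// derive1_reverse.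
rewrite !u3_nolift// ?oppr0// => -[th] /is_angle_lift_reverse; rewrite reverseK => lth.
by apply: nl; eexists; exact: lth.
Qed.

(** * Invariance of the length, the formula for [d_c] and its symmetry *)

Section length.
Variables (R : realType) (xi : R) (C : R2S1 R -> R).
Hypothesis C_ge0 : forall p, 0 <= C p.

Let integrand_ge0 (g : R -> R2S1 R) (t : R) :
  (0 <= (C (g t) * Num.sqrt (xi ^+ 2 * `|u1 g t| ^+ 2 + `|u3 g t| ^+ 2))%:E)%E.
Proof. by rewrite lee_fin mulr_ge0 ?sqrtr_ge0. Qed.

Lemma curve_length_ge0 (g : R -> R2S1 R) : (0 <= curve_length xi C g)%E.
Proof. exact: integral_ge0. Qed.

Lemma curve_length_reverse (g : R -> R2S1 R) :
  curve_length xi C (reverse g) = curve_length xi C g.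
Proof.
rewrite /curve_length (ge0_integral_cc_oo _ _ _ _ (integrand_ge0 g)).
rewrite (ge0_integral_cc_oo _ _ _ _ (integrand_ge0 (reverse g))).
rewrite -(ge0_integral_reverse _ _ (integrand_ge0 g)).
apply: eq_integral => t; rewrite inE /= => t01.
by rewrite u1_reverse u3_reverse// !normrN.
Qed.

Hypothesis C_bar : forall p, C p = C (bar p).

Lemma curve_length_flip (g : R -> R2S1 R) :
  curve_length xi C (flip g) = curve_length xi C g.
Proof.
rewrite /curve_length (ge0_integral_cc_oo _ _ _ _ (integrand_ge0 g)).
rewrite (ge0_integral_cc_oo _ _ _ _ (integrand_ge0 (flip g))).
apply: eq_integral => t; rewrite inE /= => t01.
by rewrite u1_flip u3_flip// !normrN -C_bar.
Qed.

Lemma bar_members (P : R2P1 R) (p : R2S1 R) : members P p -> members P (bar p).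
Proof.
have [q ->] := cls_surj P; rewrite members_cls /= => -[->|->]; [right|left] => //.
by rewrite /bar /= S1_oppK; case: (q).
Qed.

Lemma d_c_le_curve_length (P0 P1 : R2P1 R) (g : R -> R2S1 R) :
  Gammac P0 P1 g -> (d_c xi C P0 P1 <= curve_length xi C g)%E.
Proof.
(* A curve with [u1 <= 0] is replaced by [flip g], which has the same length and the same end point
   classes; in the equation [x' = u1 n] both factors change sign. *)
wlog u1_ge0 : g / ae01 (fun t => 0 <= u1 g t).
  move=> H Gg; have [_ _ _ _ [u1_ge0|u1_le0]] := Gg; first exact: H.
  rewrite -curve_length_flip; case: Gg => pw m0 m1 xu _.
  have u1_ge0 : ae01 (fun t => 0 <= u1 (flip g) t).
    by apply: ae01S u1_le0 => t _; rewrite u1_flip oppr_ge0.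
  apply: H => //; split; [exact: pwC1_curve_flip|exact: bar_members|exact: bar_members| |by left].
  by apply: ae01S xu => t _; rewrite u1_flip /npart /= scaleNr scalerN opprK.
case=> pw m0 m1 xu _; apply: (le_trans ((d_c_min xi C P0 P1).2 _ _ m0 m1)).
apply: ereal_inf_lbound; exists g => //; split=> //.
by apply: ae01S xu => t _ ->; exists (u1 g t).
Qed.

(** Since [n] is a unit vector, taking the dot product of [x' = c n] with [n] identifies [c] with
    [u1]. *)
Lemma Gammac_Gamma0p (P0 P1 : R2P1 R) (q0 q1 : R2S1 R) (g : R -> R2S1 R) :
  members P0 q0 -> members P1 q1 -> Gamma0p q0 q1 g -> Gammac P0 P1 g.
Proof.
move=> m0 m1 [pw g0 g1 xc u1_ge0]; split; rewrite ?g0 ?g1//; last by left.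
apply: ae01S xc => t _ [c E].
by rewrite /u1 E dotZl dot_npart mulr1.
Qed.

Lemma d_c_Gammac (P0 P1 : R2P1 R) :
  d_c xi C P0 P1 = ereal_inf [set curve_length xi C g | g in Gammac P0 P1].
Proof.
apply/eqP; rewrite eq_le; apply/andP; split.
  by apply: le_ereal_inf_tmp => _ [g Gg <-]; exact: d_c_le_curve_length.
(* The minimum is attained at some pair of representatives, and every admissible curve between them
   lies in [Gammac]. *)
have [[q0 [q1 [m0 m1 ->]]] _] := d_c_min xi C P0 P1.
apply: ereal_inf_le_tmp => _ [g Gg <-]; exists g => //.
exact: Gammac_Gamma0p Gg.
Qed.

Lemma Gammac_reverse (P0 P1 : R2P1 R) (g : R -> R2S1 R) :
  Gammac P0 P1 g -> Gammac P1 P0 (reverse g).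
Proof.
case=> pw m0 m1 xu su; split.
- exact: pwC1_curve_reverse.
- by rewrite /reverse subr0.
- by rewrite /reverse subrr.
- apply: ae01S (ae01_reverse _ _ xu) => t _.
  by rewrite derive1_xpart_reverse u1_reverse scaleNr => ->.
- case: su => [/ae01_reverse|/ae01_reverse] su; [right|left].
    by apply: ae01S su => t _; rewrite u1_reverse oppr_le0.
  by apply: ae01S su => t _; rewrite u1_reverse oppr_ge0.
Qed.

(** Reversal turns [u1 >= 0] into [u1 <= 0], so it does not preserve the condition in [Gamma0p], but
    it does preserve the constant sign in [Gammac]. Symmetry is therefore read off the second
    formula. *)
Lemma d_c_sym (P0 P1 : R2P1 R) : d_c xi C P0 P1 = d_c xi C P1 P0.
Proof.
rewrite !d_c_Gammac; congr ereal_inf; apply/seteqP.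
by split=> _ [g Gg <-]; exists (reverse g);
  rewrite ?curve_length_reverse//; exact: Gammac_reverse.
Qed.

End length.

(** * Polar coordinates and derivatives of affine and circular motions *)

Lemma cossin_surj (R : realType) (v : 'rV[R]_2) : dot v v = 1 -> exists a, v = cossin a.
Proof.
rewrite /dot !big_ord_recl big_ord0 addr0 -!expr2; set c := v 0 0.
rewrite (_ : lift 0 0 = 1); last exact: val_inj.
set s := v 0 1 => cs1.
have vE a : c = cos a -> s = sin a -> v = cossin a.
  move=> ca sa; apply/rowP => j; rewrite mxE; case: ifPn => [/eqP->//|j0].
  by rewrite (_ : j = 1)//; case: j j0 => -[|[|//]] // i ?; exact: val_inj.
have c11 : -1 <= c <= 1 by nra.
have sE : sin (acos c) = `|s|.
  by rewrite sin_acos// -cs1 addrAC subrr add0r sqrtr_sqr.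
(* [acos c] has the right cosine, and its sine is the absolute value of [s]; the sign of [s] decides
   between this angle and its opposite. *)
have [s0|s0] := leP 0 s.
  by exists (acos c); apply: vE; rewrite ?acosK ?in_itv// sE ger0_norm.
exists (- acos c); apply: vE; first by rewrite cosN acosK ?in_itv.
by rewrite sinN sE ltr0_norm// opprK.
Qed.

Lemma polar_form (R : realType) (v : 'rV[R]_2) :
  exists r b, 0 <= r /\ v = r *: cossin b.
Proof.
have vv0 : 0 <= dot v v by rewrite /dot sumr_ge0// => i _; rewrite -expr2 sqr_ge0.
have [vv|vv] := eqVneq (dot v v) 0.
  exists 0, 0; split=> //; rewrite scale0r; apply/rowP => j; rewrite mxE.
  move: vv; rewrite /dot => /eqP; rewrite psumr_eq0; last by move=> i _; rewrite -expr2 sqr_ge0.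
  by move=> /allP /(_ j (mem_index_enum _)); rewrite /= -expr2 sqrf_eq0 => /eqP.
pose r := Num.sqrt (dot v v).
have r0 : r != 0 by rewrite sqrtr_eq0 -ltNge lt_neqAle eq_sym vv.
have [|b vb] := cossin_surj _ (r^-1 *: v).
  rewrite dotZl (_ : dot v _ = r^-1 * dot v v).
    by rewrite -[dot v v]sqr_sqrtr// -/r; field.
  by rewrite /dot mulr_sumr; apply: eq_bigr => i _; rewrite mxE mulrCA.
by exists r, b; split; [exact: sqrtr_ge0|rewrite -vb scalerA divff// scale1r].
Qed.

Lemma is_derive_affine (R : realType) (V : normedModType R) (y w : V) (t : R) :
  is_derive t (1 : R) (fun s : R => y + s *: w) w.
Proof.
have d : differentiable (fun s : R => s *: w) t.
  exact: (@ex_diff _ _ _ _ _ _ _ (is_diff_scalel _ _)).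
have -> : (fun s : R => y + s *: w) = cst y + (fun s : R => s *: w) by [].
apply: is_derive_eq; last exact: add0r.
apply: is_deriveD.
apply: DeriveDef; first exact/derivable1_diffP.
rewrite deriveE// (@diff_val _ _ _ _ _ _ _ (is_diff_scalel _ _)).
by rewrite scale1r.
Qed.

(** Writing the derivative as a quarter turn keeps it in terms of [cossin], so its continuity
    follows from that of [cossin]. *)
Lemma is_derive_cossin (R : realType) (al be t : R) :
  is_derive t (1 : R) (fun s : R => cossin (al + be * s)) (be *: cossin (al + be * t + pi / 2)).
Proof.
have daff : is_derive t (1 : R) (fun s : R => al + be * s) be.
  have := is_derive_affine _ R^o al be t.
  by rewrite (_ : (fun s => _) = fun s : R => al + be * s)//; apply/funext => s; rewrite mulrC.
have dc : is_derive t (1 : R) (fun s : R => cos (al + be * s)) (- sin (al + be * t) * be).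
  exact: (is_derive1_comp (is_derive_cos _)).
have ds : is_derive t (1 : R) (fun s : R => sin (al + be * s)) (cos (al + be * t) * be).
  exact: (is_derive1_comp (is_derive_sin _)).
have D : derivable (fun s : R => cossin (al + be * s)) t 1.
  apply/derivable_mxP => i j; rewrite [X in derivable X](_ : _ = if j == 0 then
    fun s => cos (al + be * s) else fun s => sin (al + be * s)).
    by case: ifP => _; exact: ex_derive.
  by apply/funext => s; rewrite mxE; case: ifP.
apply: DeriveDef => //; rewrite derive_mx//; apply/matrixP => i j; rewrite !mxE.
rewrite cosDpihalf sinDpihalf [X in derive X](_ : _ = if j == 0 then
    fun s => cos (al + be * s) else fun s => sin (al + be * s)).
  by case: ifP => _; rewrite derive_val mulrC.
by apply/funext => s; rewrite mxE; case: ifP.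
Qed.

Lemma continuous_affine (R : realType) (al be : R) : continuous (fun t : R => al + be * t).
Proof. by move=> t; apply: cvgD; [exact: cvg_cst|apply: cvgMr; exact: cvg_id]. Qed.

Lemma continuous_cossin (R : realType) : continuous (@cossin R).
Proof.
move=> t; have := is_derive_cossin R 0 1 t.
rewrite (_ : (fun s => _) = @cossin R); last by apply/funext => s; rewrite add0r mul1r.
move=> d; apply: differentiable_continuous; apply/derivable1_diffP; exact: ex_derive.
Qed.

Lemma derive1_itvoo (R : realType) (V : normedModType R) (f g : R -> V) (a b t : R) :
  (forall s, s \in `[a, b] -> f s = g s) -> t \in `]a, b[ -> derive1 f t = derive1 g t.
Proof.
move=> fg tab; rewrite !derive1E; apply: near_eq_derive; have := near_in_itvoo tab.
apply: (@filterS _ (nbhs t)) => s sab.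
by apply: fg; move: sab; rewrite !in_itv /= => /andP[/ltW-> /ltW->].
Qed.

(** * Pieces of curves with constant controls *)

Section affine_piece.
Variables (R : realType) (g : R -> R2S1 R) (theta : R -> R) (a b : R).
Variables (y : 'rV[R]_2) (mu phi al be : R).
Hypothesis xE : forall t, t \in `[a, b] -> xpart g t = y + t *: (mu *: cossin phi).
Hypothesis thetaE : forall t, t \in `[a, b] -> theta t = al + be * t.
Hypothesis gE : forall t, (g t).2 = angle (theta t).
Hypothesis lift : is_angle_lift g theta.

Lemma affine_piece_x : C1_on a b (xpart g).
Proof.
exists (fun t => y + t *: (mu *: cossin phi)); split=> // [t|].
  exact: (@ex_derive _ _ _ _ _ _ _ (is_derive_affine _ _ _ _ _)).
rewrite (_ : derive1 _ = cst (mu *: cossin phi)); first exact: cst_continuous.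
by apply/funext => t; rewrite derive1E; apply: derive_val; exact: is_derive_affine.
Qed.

Lemma affine_piece_n : C1_on a b (npart g).
Proof.
exists (fun t => cossin (al + be * t)); split.
- by move=> t; exact: (@ex_derive _ _ _ _ _ _ _ (is_derive_cossin _ _ _ _)).
- rewrite (_ : derive1 _ = fun t => be *: cossin (al + pi / 2 + be * t)).
    move=> t; apply: cvgZr; apply: (@cvg_comp _ _ _ (fun t => al + pi / 2 + be * t) (@cossin R)).
      exact: continuous_affine.
    exact: continuous_cossin.
  apply/funext => t; rewrite derive1E addrAC; apply: derive_val; exact: is_derive_cossin.
- by move=> t tab; rewrite /npart gE -thetaE.
Qed.

Hypothesis steer : mu = 0 \/ (al = phi /\ be = 0).
Hypotheses (a0 : 0 <= a) (b1 : b <= 1).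

(** By [steer] the piece either turns on the spot or moves with constant heading [phi]; in both
    cases the velocity [mu *: cossin phi] equals [mu *: n]. *)
Lemma affine_piece_derive1 (t : R) : t \in `]a, b[ ->
  [/\ derive1 (xpart g) t = mu *: npart g t, u1 g t = mu & u3 g t = be].
Proof.
move=> tab; have tab' : t \in `[a, b].
  by move: tab; rewrite !in_itv /= => /andP[/ltW-> /ltW->].
have t01 : t \in `]0, 1[.
  move: tab; rewrite !in_itv /= => /andP[at_ tb].
  by rewrite (le_lt_trans a0 at_) (lt_le_trans tb b1).
have dx : derive1 (xpart g) t = mu *: npart g t.
  rewrite (derive1_itvoo _ _ _ _ _ _ _ xE tab) derive1E.
  rewrite (@derive_val _ _ _ _ _ _ _ (is_derive_affine _ _ _ _ _)).
  case: steer => [->|[alE be0]]; first by rewrite !scale0r.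
  by rewrite /npart gE thetaE// be0 mul0r addr0 alE.
split=> //; first by rewrite /u1 dx dotZl dot_npart mulr1.
rewrite (u3E _ _ _ _ lift)// (derive1_itvoo _ _ _ _ _ _ _ thetaE tab) derive1E.
have := is_derive_affine _ R^o al be t.
rewrite (_ : (fun s => _) = fun s : R => al + be * s); last first.
  by apply/funext => s; rewrite mulrC.
by move=> d; rewrite derive_val.
Qed.

End affine_piece.

(** * The turn-drive-turn curve and the finiteness of [d_c] *)

(** The clock of one phase: it rises linearly from 0 to 1 while [t] runs from [k / 3] to
    [(k + 1) / 3], and is constant before and after. *)
Definition ramp {R : realType} (k t : R) : R := Num.max 0 (Num.min 1 (3 * t - k)).

Lemma continuous_ramp (R : realType) (k : R) : continuous (ramp k).
Proof.
move=> t; have cl : {for t, continuous (fun t : R => 3 * t - k : R^o)}.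
  by apply: cvgB; [apply: cvgMr; exact: cvg_id|exact: cvg_cst].
have c1 : {for t, continuous (fun=> 1 : R^o)} by exact: cvg_cst.
have c0 : {for t, continuous (fun=> 0 : R^o)} by exact: cvg_cst.
exact: (continuous_max c0 (continuous_min c1 cl)).
Qed.

Lemma ramp0 (R : realType) (k t : R) : 3 * t <= k -> ramp k t = 0.
Proof. by move=> tk; rewrite /ramp min_r ?max_l//; lra. Qed.

Lemma ramp1 (R : realType) (k t : R) : k + 1 <= 3 * t -> ramp k t = 1.
Proof. by move=> tk; rewrite /ramp min_l ?max_r//; lra. Qed.

Lemma ramp_affine (R : realType) (k t : R) : k <= 3 * t <= k + 1 -> ramp k t = 3 * t - k.
Proof. by move=> tk; rewrite /ramp min_r ?max_r//; lra. Qed.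

(* Turn from the angle [a] to [b], drive the distance [r] in the direction [b],
   then turn to [c], each during one third of the unit time. *)
Definition steering_angle {R : realType} (a b c t : R) : R :=
  a + ramp 0 t * (b - a) + ramp 2 t * (c - b).

Definition steering {R : realType} (x0 : 'rV[R]_2) (r a b c t : R) : R2S1 R :=
  (x0 + ramp 1 t *: (r *: cossin b), angle (steering_angle a b c t)).

Section steering.
Variables (R : realType) (x0 : 'rV[R]_2) (r a b c : R).
Hypothesis r_ge0 : 0 <= r.
Let g := steering x0 r a b c.
Let theta := steering_angle a b c.

Lemma continuous_steering_angle : continuous theta.
Proof.
move=> t; apply: cvgD; first apply: cvgD; first exact: cvg_cst.
  by apply: cvgMl; exact: continuous_ramp.
by apply: cvgMl; exact: continuous_ramp.
Qed.

Lemma steering_lift : is_angle_lift g theta.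
Proof. by split=> //; exact: continuous_subspaceT continuous_steering_angle. Qed.

(** The decomposition into three phases is stated for an arbitrary property of an interval and its
    two constant controls, so that it serves both for regularity and for the values of the
    controls. *)
Let pieces (P : R -> R -> R -> R -> Prop) :
  (forall u v y mu al be,
    (forall t, t \in `[u, v] -> xpart g t = y + t *: (mu *: cossin b)) ->
    (forall t, t \in `[u, v] -> theta t = al + be * t) ->
    mu = 0 \/ (al = b /\ be = 0) -> 0 <= u -> v <= 1 -> P u v mu be) ->
  [/\ P 0 (1/3) 0 (3 * (b - a)), P (1/3) (2/3) (3 * r) 0 & P (2/3) 1 0 (3 * (c - b))].
Proof.
move=> H; split.
- apply: (H _ _ x0 _ a); [move=> t|move=> t|by left|lra|lra]; rewrite in_itv /= => t01.
    by rewrite /xpart /g /steering /= ramp0 ?scale0r ?scaler0//; lra.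
  by rewrite /theta /steering_angle (ramp0 _ 2) ?ramp_affine; lra.
(* In this phase [ramp 1 t = 3 * t - 1], which gives the offset [- r *: cossin b] and the speed
   [3 * r]. *)
- apply: (H _ _ (x0 - r *: cossin b) _ b); [move=> t|move=> t|by right|lra|lra];
    rewrite in_itv /= => t01.
    rewrite /xpart /g /steering /= ramp_affine; last lra.
    by apply/rowP => j; rewrite !mxE; ring.
  by rewrite /theta /steering_angle (ramp0 _ 2) ?ramp1; lra.
(* Here the angle is [b + (3 * t - 2) * (c - b)], with constant term [b - 2 * (c - b)]. *)
- apply: (H _ _ (x0 + r *: cossin b) _ (b - 2 * (c - b)));
    [move=> t|move=> t|by left|lra|lra]; rewrite in_itv /= => t01.
    by rewrite /xpart /g /steering /= ramp1 ?scale1r ?scale0r ?scaler0 ?addr0//; lra.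
  by rewrite /theta /steering_angle (ramp_affine _ 2) ?(ramp1 _ 0); lra.
Qed.

Let pieces_C1 (V : normedModType R) (f : R -> V) :
  [/\ C1_on 0 (1/3) f, C1_on (1/3) (2/3) f & C1_on (2/3) 1 f] -> piecewise_C1 f.
Proof.
case=> f1 f2 f3; exists [:: 1/3; 2/3; 1]; split=> //.
  by rewrite /= andbT; apply/and3P; split; lra.
by case=> [|[|[|]]].
Qed.

Lemma steering_pwC1 : pwC1_curve g.
Proof.
split; apply: pieces_C1.
  apply: (pieces (fun u v _ _ => C1_on u v (xpart g))) => u v y mu al be xE _ _ _ _.
  exact: affine_piece_x xE.
apply: (pieces (fun u v _ _ => C1_on u v (npart g))) => u v y mu al be _ thE _ _ _.
by apply: affine_piece_n thE _.
Qed.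

Let knots := [:: 0; 1/3; 2/3; 1 : R].

(** Recording that the controls take only three pairs of values provides the bound on the length
    integrand below. *)
Lemma steering_derive1 (t : R) : t \in `[0, 1] -> t \notin knots ->
  exists2 mu, (0 <= mu) & exists2 be, (mu, be) \in
    [:: (0, 3 * (b - a)); (3 * r, 0); (0, 3 * (c - b))] &
  [/\ derive1 (xpart g) t = mu *: npart g t, u1 g t = mu & u3 g t = be].
Proof.
rewrite in_itv /= !inE !negb_or => /andP[t0 t1] /and4P[n0 n1 n2 n3].
have [P1 P2 P3] := pieces (fun u v mu be => forall t, t \in `]u, v[ ->
    [/\ derive1 (xpart g) t = mu *: npart g t, u1 g t = mu & u3 g t = be])
  (fun u v y mu al be xE thE st u0 v1 =>
    affine_piece_derive1 _ _ _ _ _ _ _ _ _ _ xE thE (fun=> erefl) steering_lift st u0 v1).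
have {}t0 : 0 < t by rewrite lt_neqAle eq_sym n0.
have {}t1 : t < 1 by rewrite lt_neqAle n3.
have [t13|t13] := ltP t (1/3).
  exists 0 => //; exists (3 * (b - a)); first by rewrite !inE eqxx.
  by apply: P1; rewrite in_itv /= t0.
have {}t13 : 1/3 < t by rewrite lt_neqAle eq_sym n1.
have [t23|t23] := ltP t (2/3).
  exists (3 * r); first by rewrite mulr_ge0.
  exists 0; first by rewrite !inE eqxx orbT.
  by apply: P2; rewrite in_itv /= t13.
have {}t23 : 2/3 < t by rewrite lt_neqAle eq_sym n2.
exists 0 => //; exists (3 * (c - b)); first by rewrite !inE eqxx !orbT.
by apply: P3; rewrite in_itv /= t23.
Qed.

Lemma steering_Gamma0p :
  Gamma0p (x0, angle a) (x0 + r *: cossin b, angle c) g.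
Proof.
split.
- exact: steering_pwC1.
- have r0 k : 0 <= k -> ramp k 0 = 0 :> R by move=> k0; apply: ramp0; lra.
  by rewrite /g /steering /steering_angle !r0// scale0r !mul0r !addr0.
- have r1 k : k <= 2 -> ramp k 1 = 1 :> R by move=> k2; apply: ramp1; lra.
  rewrite /g /steering /steering_angle !r1//; last lra.
  by rewrite scale1r !mul1r (addrC a) subrK (addrC b) subrK.
- apply: (ae01_finite _ knots) => t t01 tk.
  by have [mu _ [be _ [dx _ _]]] := steering_derive1 t t01 tk; exists mu.
- apply: (ae01_finite _ knots) => t t01 tk.
  by have [mu mu0 [be _ [_ -> _]]] := steering_derive1 t t01 tk.
Qed.

Lemma steering_length_lty (xi : R) (C : R2S1 R -> R) :
  C1_cost C -> (forall p, 0 <= C p) -> (curve_length xi C g < +oo)%E.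
Proof.
move=> [dC _] C0.
(* [C1_cost] speaks of [C] in the chart given by the angle, so continuity is obtained by composing
   with the continuous curve of positions and lifted angles. *)
have cC : continuous (fun t => C (g t)).
  move=> t; have cx : {for t, continuous (fun t : R => x0 + ramp 1 t *: (r *: cossin b))}.
    apply: cvgD; first exact: cvg_cst.
    by apply: cvgZl; exact: continuous_ramp.
  have cp : {for t, continuous (fun t : R => (x0 + ramp 1 t *: (r *: cossin b), theta t))}.
    exact: (cvg_pair cx (continuous_steering_angle t)).
  exact: (continuous_comp cp (differentiable_continuous (dC _))).
have [t0 _ CM] := EVT_max ler01 (continuous_subspaceT cC).
pose F t := C (g t) * Num.sqrt (xi ^+ 2 * `|u1 g t| ^+ 2 + `|u3 g t| ^+ 2).
pose K (p : R * R) := Num.sqrt (xi ^+ 2 * `|p.1| ^+ 2 + `|p.2| ^+ 2).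
have F0 t : 0 <= F t by rewrite mulr_ge0 ?sqrtr_ge0.
(* A bound valid at every point: the maximal cost times the sum over the three pairs of controls,
   plus the integrand at the knots, where no formula for the derivatives is available. *)
pose M := C (g t0) * (\sum_(p <- [:: (0, 3 * (b - a)); (3 * r, 0); (0, 3 * (c - b))]) K p)
   + \sum_(s <- knots) F s.
have FM t : t \in `[0, 1] -> F t <= M.
  move=> t01; have [tk|tk] := boolP (t \in knots).
    rewrite /M (big_rem _ tk) /= addrCA lerDl addr_ge0 ?sumr_ge0//.
    by rewrite mulr_ge0// sumr_ge0// => p _; exact: sqrtr_ge0.
  have [mu mu0 [be mube [_ u1E u3E]]] := steering_derive1 t t01 tk.
  rewrite /M -[leLHS]addr0 lerD ?sumr_ge0// /F ler_pM ?sqrtr_ge0// ?CM//.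
  rewrite (big_rem _ mube) /= u1E u3E lerDl sumr_ge0// => p _; exact: sqrtr_ge0.
apply: (@le_lt_trans _ _ (\int[lebesgue_measure]_(t in `[0%R, 1%R]) M%:E)%E).
  by apply: ge0_le_integral_nomeas => t t01; rewrite lee_fin; [exact: F0|exact: FM].
by rewrite integral_cst//= lebesgue_measure_itv /= lte_fin ltr01 oppr0 adde0 mule1 ltry.
Qed.

End steering.

Lemma d_c_lty (R : realType) (xi : R) (C : R2S1 R -> R) (P0 P1 : R2P1 R) :
  C1_cost C -> (forall p, 0 <= C p) -> (d_c xi C P0 P1 < +oo)%E.
Proof.
move=> CC1 C0; have [[x0 n0] ->] := cls_surj P0; have [[x1 n1] ->] := cls_surj P1.
have angle_surj (n : S1 R) : exists a, n = angle a.
  have [a na] := cossin_surj _ (val n) (eqP (valP n)).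
  by exists a; exact: val_inj.
have [[a ->] [c ->]] := (angle_surj n0, angle_surj n1).
(* The displacement in polar form supplies the distance [r] to drive and the heading [b]. *)
have [r [b [r0 xE]]] := polar_form _ (x1 - x0).
have {xE} -> : x1 = x0 + r *: cossin b by rewrite -xE addrC subrK.
apply: le_lt_trans (steering_length_lty _ x0 r a b c r0 xi C CC1 C0).
apply: (le_trans ((d_c_min xi C _ _).2 _ _ erefl erefl)).
by apply: ereal_inf_lbound; exists (steering x0 r a b c) => //; exact: steering_Gamma0p.
Qed.

Theorem proposition1 (R : realType) (xi delta : R) (C : R2S1 R -> R)
    (xi_gt0 : 0 < xi) (delta_gt0 : 0 < delta)
    (C_C1 : C1_cost C) (C_ge : forall p : R2S1 R, delta <= C p)
    (C_bar : forall p : R2S1 R, C p = C (bar p)) :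
  [/\ forall P0 P1 : R2P1 R, (0 <= d_c xi C P0 P1 < +oo)%E,
      forall P0 P1 : R2P1 R, d_c xi C P0 P1 = d_c xi C P1 P0 &
      forall P0 P1 : R2P1 R,
        d_c xi C P0 P1 = ereal_inf [set curve_length xi C g | g in Gammac P0 P1]].
Proof.
have C_ge0 p : 0 <= C p by exact: le_trans (ltW delta_gt0) (C_ge p).
split=> P0 P1; last exact: d_c_Gammac.
- rewrite d_c_lty// andbT d_c_Gammac//.
  by apply: le_ereal_inf_tmp => _ [g _ <-]; exact: curve_length_ge0.
- exact: d_c_sym.
Qed.
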